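(* For every $n\ge1$, $$I_n(q,t,x)=tx\,I_{n-1}(q,t,x)+\sum_{k=0}^{n-2}q^{k+1}I_k(q,t,1)\Big[I_{n-1-k}(q,t,x)-t(x-1)\,I_{n-2-k}(q,t,x)\Big].$$
   Context: $\mathrm{Av}_n(321)$ is the set of permutations $\sigma=a_1\ldots a_n$ of $[n]$ with no $i<j<k$ such that $a_i>a_j>a_k$ (for $n=0$, only the empty permutation). $\mathrm{inv}\,\sigma=\#\{(i,j):i<j,\ a_i>a_j\}$; $\mathrm{lrm}\,\sigma$ is the number of $i$ with $a_i=\max\{a_1,\dots,a_i\}$; $\mathrm{fix}\,\sigma=\#\{i:a_i=i\}$. Let $I_n(q,t,x)=\sum_{\sigma\in\mathrm{Av}_n(321)}q^{\mathrm{inv}\,\sigma}t^{\mathrm{lrm}\,\sigma}x^{\mathrm{fix}\,\sigma}$, so $I_0=1$. *)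

(* Defs.v *)
From HB Require Import structures.
From mathcomp Require Import all_boot all_order all_fingroup all_algebra.

Set Implicit Arguments.
Unset Strict Implicit.
Unset Printing Implicit Defensive.

(* The word a_1 ... a_n of a permutation is represented by s : 'S_n, whose    *)
(* positions and values are both numbered from 0: a_(i.+1) = (s i).+1.        *)

Definition Av321 (n : nat) : {set 'S_n} :=
  [set s : 'S_n | ~~ [exists i : 'I_n, exists j : 'I_n, exists k : 'I_n,
     (i < j < k)%N && (s k < s j < s i)%N]].

Definition inv (n : nat) (s : 'S_n) : nat :=
  #|[set p : 'I_n * 'I_n | (p.1 < p.2)%N && (s p.2 < s p.1)%N]|.

Definition lrm (n : nat) (s : 'S_n) : nat :=
  #|[set i : 'I_n | (s i : nat) == (\max_(j < n | (j <= i)%N) s j)%N]|.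

Definition fix_count (n : nat) (s : 'S_n) : nat :=
  #|[set i : 'I_n | s i == i]|.

(* The polynomial I_n(q,t,x), evaluated at elements of a commutative ring;    *)
(* the polynomial itself is the case of three indeterminates over int.        *)
Definition I_ (R : comNzRingType) (n : nat) (q t x : R) : R :=
  (\sum_(s in Av321 n) q ^+ inv s * t ^+ lrm s * x ^+ fix_count s)%R.

(* Main.v *)
(** Delete the first letter a of a 321-avoiding permutation: the values below
    a must then occur in increasing order in the rest.  Hence let F(n, h) be
    the generating function of the 321-avoiding permutations of size n in which
    no inversion starts at a value below h, where only values at least h count
    for lrm and fix (values are numbered from 0, so that F(n, 0) = I_n).
    Deletion of the first letter gives
      F(n+1, h) = [h > 0] F(n, h-1) + G(n, h),
      G(n, h) = sum_(h <= a <= n) t q^a x^[a = 0] F(n, a).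
    Induction on n, for all h at once, then shows
      G(n, h+1) = sum_(k < n) q^(k+1) F(k, h)|_(x=1) H(n-1-k),
      H(m) = G(m, 1) + t F(m, 0) = I_(m+1) - t (x-1) I_m,
    since both sides obey the same recurrence in n and h; the theorem is the
    case h = 0.  F, G and H are level_gf, jump_gf and start_gf. *)

Require Import Defs.
From HB Require Import structures.
From mathcomp Require Import all_boot all_order all_fingroup all_algebra.
From mathcomp Require Import zify ring.

Set Implicit Arguments.
Unset Strict Implicit.
Unset Printing Implicit Defensive.

Import GRing.Theory.
Local Open Scope ring_scope.

(** * Permutations built from a first letter and the pattern of the rest *)

Definition cons_perm (n : nat) (a : 'I_n.+1) (s : 'S_n) : 'S_n.+1 :=
  lift_perm ord0 a s.

Lemma cons_perm0 n a (s : 'S_n) : cons_perm a s ord0 = a.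
Proof. exact: lift_perm_id. Qed.

Lemma cons_permS n a (s : 'S_n) i :
  cons_perm a s (lift ord0 i) = bump a (s i) :> nat.
Proof. by rewrite /cons_perm lift_perm_lift. Qed.

Lemma cons_perm_bij n :
  bijective (fun p : 'I_n.+1 * 'S_n => cons_perm p.1 p.2).
Proof.
apply: inj_card_bij => [[a s] [b u] /= eq_su|]; last first.
  by rewrite card_prod card_ord !card_Sn factS.
have eq_ab : a = b by rewrite -(cons_perm0 a s) eq_su cons_perm0.
congr pair => //; apply/permP => i; apply: (@lift_inj _ a).
by rewrite -(lift_perm_lift ord0) -/(cons_perm a s) eq_su {1}eq_ab lift_perm_lift.
Qed.

Lemma sum_perm_lt n (s : 'S_n) a : (a <= n)%N ->
  (\sum_(j < n) (s j < a) = a)%N.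
Proof.
move=> le_an; rewrite -[RHS](card_ord a) -sum1_card.
rewrite (big_ord_widen n (fun=> 1%N) le_an) [RHS]big_mkcond /=.
rewrite [RHS](reindex_inj (@perm_inj _ s)) /=.
by apply: eq_bigr => j _; case: ifP.
Qed.

(** * Statistics and avoidance relative to a threshold [h] on values *)

Definition lrm_above (h n : nat) (s : 'S_n) : nat :=
  \sum_(i < n) ((h <= s i)%N && [forall j : 'I_n, (j <= i)%N ==> (s j <= s i)%N]).

Definition fix_above (h n : nat) (s : 'S_n) : nat :=
  \sum_(i < n) ((h <= s i)%N && (s i == i :> nat)).

(** For [h > n] the other two clauses would still admit the identity; the bound [h <= n] makes the
    generating function vanish there. *)
Definition admissible (h n : nat) (s : 'S_n) : bool :=
  [&& (h <= n)%N, s \in Av321 n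
    & [forall i : 'I_n, forall j : 'I_n,
        (i < j)%N && (s j < s i)%N ==> (h <= s i)%N]].

Lemma admissibleP h n (s : 'S_n) :
  reflect [/\ (h <= n)%N,
              (forall i j k : 'I_n, (i < j)%N -> (j < k)%N ->
                 (s k < s j)%N -> (s j < s i)%N -> False)
            & (forall i j : 'I_n, (i < j)%N -> (s j < s i)%N -> (h <= s i)%N)]
          (admissible h s).
Proof.
apply: (iffP and3P) => -[le_hn av low]; split=> //.
- move=> i j k ij jk skj sji; move: av; rewrite inE => /negP[].
  apply/existsP; exists i; apply/existsP; exists j; apply/existsP; exists k.
  by rewrite ij jk skj sji.
- by move=> i j ij sji; move/forallP/(_ i)/forallP/(_ j)/implyP: low; apply; rewrite ij.
- rewrite inE; apply/negP => /existsP[i /existsP[j /existsP[k]]].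
  by move=> /andP[/andP[ij jk] /andP[skj sji]]; exact: av ij jk skj sji.
- by apply/forallP=> i; apply/forallP=> j; apply/implyP=> /andP[]; exact: low.
Qed.

Lemma admissible_cons h n a (s : 'S_n) :
  admissible h (cons_perm a s) =
    if (h <= a)%N then admissible a s else (a == 0%N :> nat) && admissible h.-1 s.
Proof.
case: leqP => [le_ha | lt_ah]; last case: eqP => [a0 | nz_a] /=.
- apply/admissibleP/admissibleP => -[le_hn av low]; split.
  + by have := ltn_ord a; lia.
  + move=> i j k ij jk skj sji; apply: (av (lift ord0 i) (lift ord0 j) (lift ord0 k)) => //;
    by rewrite !cons_permS /bump; lia.
  (* An inversion of [s] starting at a value below [a] would complete a 321 pattern with the first
     letter. *)
  + move=> i j ij sji; rewrite leqNgt; apply/negP => lt_sia.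
    apply: (av ord0 (lift ord0 i) (lift ord0 j)) => //;
    by rewrite ?cons_perm0 !cons_permS /bump; lia.
  + by have := ltn_ord a; lia.
  + move=> i j k; case: (unliftP ord0 i) => [i'|] ->;
    case: (unliftP ord0 j) => [j'|] -> //; case: (unliftP ord0 k) => [k'|] -> //;
    rewrite ?cons_perm0 ?cons_permS ?lift0 /= ?ltnS.
      by move=> ij jk skj sji; apply: (av i' j' k') => //; move: skj sji; rewrite /bump; lia.
    move=> _ jk skj sja; have := low j' k' jk.
    by move: skj sja; rewrite /bump; lia.
  + move=> i j; case: (unliftP ord0 i) => [i'|] ->;
    case: (unliftP ord0 j) => [j'|] -> //;
    rewrite ?cons_perm0 ?cons_permS ?lift0 /= ?ltnS //.
    by move=> ij sji; have := low i' j' ij; move: sji; rewrite /bump; lia.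
- apply/admissibleP/admissibleP => -[le_hn av low]; split.
  + by lia.
  + move=> i j k ij jk skj sji; apply: (av (lift ord0 i) (lift ord0 j) (lift ord0 k)) => //;
    by rewrite !cons_permS /bump; lia.
  + move=> i j ij sji; have := low (lift ord0 i) (lift ord0 j).
    by rewrite !cons_permS /bump !lift0; lia.
  + by lia.
  + move=> i j k; case: (unliftP ord0 i) => [i'|] ->;
    case: (unliftP ord0 j) => [j'|] -> //; case: (unliftP ord0 k) => [k'|] -> //;
    rewrite ?cons_perm0 ?cons_permS ?lift0 /= ?ltnS.
      by move=> ij jk skj sji; apply: (av i' j' k') => //; move: skj sji; rewrite /bump; lia.
    by rewrite a0.
  + move=> i j; case: (unliftP ord0 i) => [i'|] ->;
    case: (unliftP ord0 j) => [j'|] -> //;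
    rewrite ?cons_perm0 ?cons_permS ?lift0 /= ?ltnS //; last by rewrite a0.
    by move=> ij sji; have := low i' j' ij; move: sji; rewrite /bump; lia.
(* The value 0 occurs after a nonzero first letter [a], so an inversion starts at [a < h]. *)
- apply/negP => /admissibleP[le_hn _ low].
  have [i eq_i] : exists i, ord0 = cons_perm a s i.
    by exists ((cons_perm a s)^-1%g ord0); rewrite permKV.
  case: (unliftP ord0 i) eq_i => [i'|] -> eq_i.
    have := low ord0 (lift ord0 i'); rewrite cons_perm0 -eq_i lift0 lt0n.
    by move=> /(_ isT); rewrite /= lt0n => /(_ (introN eqP nz_a)); lia.
  by move: eq_i nz_a; rewrite cons_perm0 => <-.
Qed.

Lemma inv_sum n (s : 'S_n) :
  Defs.inv s = (\sum_(i < n) \sum_(j < n) ((i < j)%N && (s j < s i)%N))%N.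
Proof.
rewrite /Defs.inv cardsE -sum1_card pair_bigA big_mkcond /=.
by apply: eq_bigr => p _; rewrite unfold_in; case: ifP.
Qed.

Lemma inv_cons n a (s : 'S_n) : Defs.inv (cons_perm a s) = (a + Defs.inv s)%N.
Proof.
rewrite !inv_sum big_ord_recl; congr (_ + _)%N.
  rewrite big_ord_recl /= add0n -[RHS](sum_perm_lt s (ltn_ord a)).
  by apply: eq_bigr => j _; rewrite cons_perm0 cons_permS /bump; lia.
apply: eq_bigr => i _; rewrite big_ord_recl /= add0n.
by apply: eq_bigr => j _; rewrite !cons_permS /bump; lia.
Qed.

(** The first letter is always a record, and it hides exactly the later records with smaller values,
    so the threshold rises to [a]. If [a < h], then [a] is 0 and is not counted, while all other
    values shift by one. *)
Lemma lrm_above_cons h n a (s : 'S_n) : admissible h (cons_perm a s) ->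
  lrm_above h (cons_perm a s) =
    if (h <= a)%N then (lrm_above a s).+1 else lrm_above h.-1 s.
Proof.
rewrite admissible_cons.
case: leqP => [le_ha _ | lt_ah /andP[/eqP a0 _]].
all: rewrite /lrm_above big_ord_recl cons_perm0.
- rewrite le_ha; have -> : [forall j : 'I_n.+1, (j <= @ord0 n)%N ==> (cons_perm a s j <= a)%N].
    apply/forallP => j; case: (unliftP ord0 j) => [j'|] ->; first by rewrite lift0.
    by rewrite cons_perm0 !leqnn.
  rewrite add1n; congr _.+1; apply: eq_bigr => i _; congr nat_of_bool.
  rewrite cons_permS; apply/andP/andP => -[le_si /forallP lrm_i]; split.
  + by have := lrm_i ord0; rewrite cons_perm0 /= /bump; lia.
  + apply/forallP => j; have := lrm_i (lift ord0 j).
    by rewrite cons_permS !lift0 /bump; lia.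
  + by rewrite /bump; lia.
  + apply/forallP => j; case: (unliftP ord0 j) => [j'|] ->.
      by have := lrm_i j'; rewrite cons_permS !lift0 /bump; lia.
    by rewrite cons_perm0 /= /bump; lia.
- rewrite leqNgt lt_ah add0n; apply: eq_bigr => i _; congr nat_of_bool.
  rewrite cons_permS; apply/andP/andP => -[le_si /forallP lrm_i]; split.
  + by move: le_si; rewrite /bump; lia.
  + apply/forallP => j; have := lrm_i (lift ord0 j).
    by rewrite cons_permS !lift0 /bump; lia.
  + by rewrite /bump; lia.
  + apply/forallP => j; case: (unliftP ord0 j) => [j'|] ->.
      by have := lrm_i j'; rewrite cons_permS !lift0 /bump; lia.
    by rewrite cons_perm0 /= /bump; lia.
Qed.

Lemma admissible_low_pos h n (s : 'S_n) i :
  admissible h s -> (s i < h)%N -> (s i <= i)%N.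
Proof.
move=> /admissibleP[_ _ low] lt_sih.
(* No inversion starts at position i, so the s i smaller values all precede it. *)
rewrite -[X in (X <= _)%N](sum_perm_lt s (ltnW (ltn_ord (s i)))).
rewrite -[leqRHS](sum_perm_lt 1%g (ltnW (ltn_ord i))).
apply: leq_sum => j _; rewrite perm1.
case: (ltngtP j i) => [||/val_inj->]; rewrite ?leq_b1 ?ltnn // => ij.
by have := low i j ij; lia.
Qed.

(** Prepending [a] shifts every position, but only the values from [a] on, so their fixed points
    persist. A smaller value keeps its size and moves right; by [admissible_low_pos] it was not to
    the left of its own place, so it cannot become fixed. *)
Lemma fix_above_cons h n a (s : 'S_n) : admissible h (cons_perm a s) ->
  fix_above h (cons_perm a s) =
    if (h <= a)%N then ((a == 0%N :> nat) + fix_above a s)%N else fix_above h.-1 s.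
Proof.
rewrite admissible_cons /fix_above big_ord_recl cons_perm0.
case: leqP => [le_ha adm_s | lt_ah /andP[/eqP a0 adm_s]].
  congr (_ + _)%N; apply: eq_bigr => i _; rewrite cons_permS lift0.
  by have := admissible_low_pos (i := i) adm_s; rewrite /bump; lia.
by rewrite add0n; apply: eq_bigr => i _; rewrite cons_permS lift0 /bump; lia.
Qed.

Lemma lrm_above0 n (s : 'S_n) : lrm_above 0 s = lrm s.
Proof.
rewrite /lrm cardsE -sum1_card [RHS]big_mkcond /=.
apply: eq_bigr => i _; rewrite unfold_in -[RHS]/(nat_of_bool _); congr nat_of_bool.
rewrite -[eqn _ _]/(_ == _) eqn_leq (bigmax_sup i) //=.
by apply/forall_inP/bigmax_leqP.
Qed.

Lemma fix_above0 n (s : 'S_n) : fix_above 0 s = fix_count s.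
Proof.
rewrite /fix_count cardsE -sum1_card [RHS]big_mkcond /=.
by apply: eq_bigr => i _; rewrite unfold_in -[RHS]/(nat_of_bool (s i == i)).
Qed.

Lemma admissible0 n (s : 'S_n) : admissible 0 s = (s \in Av321 n).
Proof.
rewrite /admissible /= andb_idr // => _.
by apply/forallP=> i; apply/forallP=> j; rewrite implybT.
Qed.

(** * Generating functions and their convolution identity *)

Section Recurrence.
Variables (R : comNzRingType) (q t : R).

Definition level_gf (x : R) (n h : nat) : R :=
  \sum_(s : 'S_n | admissible h s)
    q ^+ Defs.inv s * t ^+ lrm_above h s * x ^+ fix_above h s.

Definition jump_gf (x : R) (n h : nat) : R :=
  \sum_(h <= a < n.+1) t * q ^+ a * x ^+ (a == 0%N) * level_gf x n a.

Lemma level_gf0 x n : level_gf x n 0 = I_ n q t x.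
Proof.
apply: eq_big => [s|s _]; first exact: admissible0.
by rewrite lrm_above0 fix_above0.
Qed.

Lemma level_gf_small x n h : (n < h)%N -> level_gf x n h = 0.
Proof. by move=> lt_nh; rewrite /level_gf big_pred0 // => s; rewrite /admissible leqNgt lt_nh. Qed.

Lemma level_gf00 x : level_gf x 0 0 = 1.
Proof.
rewrite level_gf0 /I_ (bigD1 1%g) /=; last by rewrite inE; apply/existsP => -[[]].
rewrite big1 ?addr0; last by move=> s /andP[_ /eqP[]]; apply/permP => -[].
have -> : lrm (1%g : 'S_0) = 0%N by apply: eq_card0 => -[].
have -> : fix_count (1%g : 'S_0) = 0%N by apply: eq_card0 => -[].
by rewrite (_ : Defs.inv _ = 0%N) ?mulr1 //; apply: eq_card0 => -[[]].
Qed.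

Lemma level_gf_rec x n h :
  level_gf x n.+1 h = (if h is h'.+1 then level_gf x n h' else 0) + jump_gf x n h.
Proof.
have [lt_nh | le_hn] := ltnP n.+1 h.
  rewrite level_gf_small // /jump_gf big_geq ?addr0; last exact: ltnW.
  by case: h lt_nh => // h lt_nh; rewrite level_gf_small.
rewrite /level_gf (reindex _ (onW_bij _ (cons_perm_bij n))) /=.
rewrite -(pair_big_dep xpredT (fun a s => admissible h (cons_perm a s))
  (fun a s => q ^+ Defs.inv (cons_perm a s) * t ^+ lrm_above h (cons_perm a s) *
              x ^+ fix_above h (cons_perm a s))) /=.
(* Among the first letters below [h], only 0 contributes. *)
rewrite (bigID (fun a : 'I_n.+1 => h <= a)%N) /= addrC; congr (_ + _).
  case: h le_hn => [|h] le_hn; first by rewrite big_pred0.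
  rewrite (bigD1 ord0) //= [X in _ + X]big1 ?addr0.
    apply: eq_big => [s|s adm_s]; first by rewrite admissible_cons.
    by rewrite fix_above_cons // lrm_above_cons // inv_cons.
  move=> a /andP[/negPf le_ha nz_a]; rewrite big_pred0 // => s.
  by rewrite admissible_cons le_ha -[a == 0%N :> nat]/(a == ord0) (negPf nz_a).
rewrite /jump_gf big_geq_mkord; apply: eq_bigr => a le_ha.
rewrite /level_gf mulr_sumr; apply: eq_big => [s|s adm_s].
  by rewrite admissible_cons le_ha.
rewrite fix_above_cons // lrm_above_cons // inv_cons le_ha exprS !exprD.
ring.
Qed.

Definition start_gf (x : R) (n : nat) : R := jump_gf x n 1 + t * level_gf x n 0.

(** Raising the first letter by one removes the factor [x] at [a = 0]. This only matters when the
    sum starts at 0, and there [start_gf] replaces [jump_gf x n 0]. *)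
Lemma sum_shift x n h :
  \sum_(h <= a < n.+1) t * q ^+ a.+1 * level_gf x n a =
    q * (if h is h'.+1 then jump_gf x n h else start_gf x n).
Proof.
have shift h' : (0 < h')%N ->
    \sum_(h' <= a < n.+1) t * q ^+ a.+1 * level_gf x n a = q * jump_gf x n h'.
  move=> h'_gt0; rewrite /jump_gf mulr_sumr; apply: eq_big_nat => a /andP[le_ha _].
  by rewrite gtn_eqF ?(leq_trans h'_gt0) // exprS; ring.
case: h => [|h]; last exact: shift.
by rewrite big_ltn // shift // /start_gf expr1; ring.
Qed.

Lemma jump_gf_convolution x n h :
  jump_gf x n h.+1 = \sum_(k < n) q ^+ k.+1 * level_gf 1 k h * start_gf x (n - k.+1).
Proof.
elim: n h => [|n IHn] h; first by rewrite /jump_gf big_geq // big_ord0.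
rewrite {1}/jump_gf big_add1 /=.
(* Each [level_gf x n.+1 a.+1] splits by the recurrence; its first part is summed by [sum_shift]. *)
have -> : \sum_(h <= a < n.+1) t * q ^+ a.+1 * x ^+ (a.+1 == 0%N) * level_gf x n.+1 a.+1 =
    q * (if h is h'.+1 then jump_gf x n h else start_gf x n)
    + \sum_(h <= a < n.+1) t * q ^+ a.+1 * jump_gf x n a.+1.
  rewrite -sum_shift -big_split /=; apply: eq_bigr => a _.
  by rewrite level_gf_rec /=; ring.
(* The induction hypothesis applies at every [a]; after exchanging the sums, the sum over [a] is a
   [jump_gf] at [x = 1]. *)
have -> : \sum_(h <= a < n.+1) t * q ^+ a.+1 * jump_gf x n a.+1 =
    \sum_(k < n) q ^+ k.+2 * jump_gf 1 k h * start_gf x (n - k.+1).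
  under eq_bigr do rewrite IHn mulr_sumr.
  rewrite exchange_big /=; apply: eq_bigr => k _.
  rewrite /jump_gf [X in _ * X * _](_ : _ = \sum_(h <= a < n.+1) t * q ^+ a * level_gf 1 k a).
    rewrite mulr_sumr mulr_suml; apply: eq_bigr => a _.
    by rewrite !exprS; ring.
  under eq_bigr do rewrite expr1n mulr1.
  (* The ranges [a <= n] and [a <= k] give the same sum, since [level_gf 1 k a] is 0 for [a > k]. *)
  have [lt_kh | le_hk] := ltnP k h.
    rewrite big_geq // big_nat big1 // => a /andP[le_ha _].
    by rewrite level_gf_small ?mulr0 // (leq_trans lt_kh).
  rewrite [RHS](@big_cat_nat _ _ _ k.+1) ?ltnS //=; [|exact: leqW|exact: ltnW].
  rewrite [X in _ + X]big_nat [X in _ + X]big1 ?addr0 // => a /andP[lt_ka _].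
  by rewrite level_gf_small ?mulr0.
(* On the right, the term [k = 0] is set apart and the others are expanded by the same recurrence,
   so that the [jump_gf] parts cancel. *)
rewrite big_ord_recl /= subn1 /= expr1.
rewrite [X in _ = _ + X](eq_bigr (fun k : 'I_n =>
    q ^+ k.+2 * (if h is h'.+1 then level_gf 1 k h' else 0) * start_gf x (n - k.+1) +
    q ^+ k.+2 * jump_gf 1 k h * start_gf x (n - k.+1))) => [|k _]; last first.
  rewrite level_gf_rec /= /bump add1n subSS.
  by case: (h) => [|h']; [rewrite add0r mulr0 mul0r add0r | ring].
rewrite big_split /= addrA; congr (_ + _).
(* For [h = 0] only the separate term remains, as [level_gf 1 0 0] is 1. For positive [h] that term
   vanishes, and the induction hypothesis one level lower gives the rest. *)
case: h => [|h].
  by rewrite level_gf00 mulr1 big1 ?addr0 // => k _; rewrite mulr0 mul0r.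
rewrite IHn level_gf_small // mulr0 mul0r add0r mulr_sumr; apply: eq_bigr => k _.
by rewrite [in RHS]exprS !mulrA.
Qed.
End Recurrence.

Theorem theorem8p4 (R : comNzRingType) (q t x : R) (n : nat) (hn : (1 <= n)%N) :
  I_ n q t x =
    t * x * I_ (n - 1) q t x
    + \sum_(0 <= k < n - 1)
        q ^+ (k + 1) * I_ k q t 1 *
          (I_ (n - 1 - k) q t x - t * (x - 1) * I_ (n - 2 - k) q t x).
Proof.
case: n hn => // n _; rewrite subn1 /= -!level_gf0.
(* The summand [a = 0] of [jump_gf x m 0] is the only one with an explicit factor [x]; it gives the
   first term of the theorem. *)
have level_gfS m : level_gf q t x m.+1 0 = t * x * level_gf q t x m 0 + jump_gf q t x m 1.
  by rewrite level_gf_rec add0r /jump_gf big_ltn // expr0 expr1 mulr1.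
rewrite level_gfS jump_gf_convolution big_mkord; congr (_ + _).
apply: eq_bigr => k _; have lt_kn := ltn_ord k.
rewrite addn1 -!level_gf0; congr (_ * _).
(* Since [k < n], no subtraction truncates, and the bracket becomes [start_gf] at [n - k.+1]. *)
have -> : (n - k = (n - k.+1).+1)%N by lia.
have -> : (n.+1 - 2 - k = n - k.+1)%N by lia.
by rewrite level_gfS /start_gf; ring.
Qed.
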